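(* Let $f:\{1,\dots,n'\}\cup\{\varnothing\}\to\mathbb{R}$ satisfy $f(\varnothing)=0$ and $f(k)>0$ for $k\in[n']$, and suppose there exist functions $p_-(r)=\Omega(1/r)$ and $p_+(r)=O(1/r)$ such that for every set $S\subseteq[n']$ with $|S|=r$ and every element $a\in S$, $$p_-(r)\le\frac{f(a)}{\sum_{k\in S}f(k)}\le p_+(r),$$ and suppose that $\max_{i\in[n']}f(i)\le c\,x$ for some constant $c$, where $x=\min_{i\in[n']}f(i)$. Consider $m$-player $f$-war with $n'$ cards, with $A_i(t)$ denoting player $i$'s hand at time $t$. Then the process $$\left(\frac1x\sum_{k\in A_i(t)}f(k)\right)_{i\in[m]},\qquad t=0,1,2,\dots,$$ is a sticky random walk.
   Context: Write $[m]=\{1,\dots,m\}$, $[n']=\{1,\dots,n'\}$; $m\ge2$. $m$-player $f$-war with $n'$ cards is the Markov chain whose states are tuples $(A_i)_{i\in[m]}$ of disjoint ordered tuples of elements of $[n']$ with $\bigsqcup_{i=1}^m A_i=[n']$ (the ordered hands). The initial hands are obtained by choosing a vector of $m$ nonnegative integers $(x_1,\dots,x_m)$ with sum $n'$, randomly shuffling the deck $[n']$ and partitioning the cards so that $|A_i(0)|=x_i$. The absorbing states are those with $|A_i|=n'$ for some $i$. At each turn, player $i$ plays the card $a_i$ at the start of $A_i(t)$ ($a_i=\varnothing$ if the hand is empty). With probability $f(a_i)/\sum_{j=1}^m f(a_j)$ player $i$ wins all played cards, which are added to the end of $A_i(t)\setminus\{a_i\}$ in arbitrary order, while every other player loses the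 card they played. A sticky random walk with total $n$ (a positive real) is a stochastic process $(A_{i,t})_{i\in[m]}$, $t\in\mathbb{N}=\{0,1,\dots\}$, with values in $\{(x_1,\dots,x_m)\in\mathbb{R}^m: x_i\ge 0 \text{ for all } i,\ \sum_{i=1}^m x_i=n\}$, adapted to a filtration (the history of the process), for which there are functions $p_-(r)=\Omega(1/r)$, $p_+(r)=O(1/r)$ and real numbers $a_-,a_+>0$ such that for every $i\in[m]$ and $t$, with $r$ denoting the number of indices $j$ with $A_{j,t}\neq 0$: (1) $(A_{i,t})_{t\in\mathbb{N}}$ is a martingale. (2) If $A_{i,t}=0$ then $A_{i,t+1}=0$. (3) If $A_{i,t+1}>A_{i,t}$ (''$A_{i,t}$ increases''), then $A_{j,t+1}<A_{j,t}$ (''$A_{j,t}$ decreases'') for all $j\ne i$ with $A_{j,t}>0$. (4) If $r\ge 2$ and $A_{i,t}>0$, then the probability, given the history up to time $t$, that $A_{i,t}$ increases lies between $p_-(r)$ and $p_+(r)$. (5) If $A_{i,t}$ decreases, then $a_-\le A_{i,t}-A_{i,t+1}\le a_+$. (6) $\sum_{i=1}^m A_{i,t}=n$. *)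

(* Defs.v *)
From HB Require Import structures.
From mathcomp Require Import all_boot all_order all_algebra all_fingroup.
From mathcomp Require Import all_classical all_reals all_analysis.

Set Implicit Arguments.
Unset Strict Implicit.
Unset Printing Implicit Defensive.

Import Order.TTheory GRing.Theory Num.Theory.

Local Open Scope classical_set_scope.
Local Open Scope ring_scope.

(* Uniform over all r >= 1: here r is a number of cards or of players, so it
   ranges over a bounded set and an "r -> oo" reading would say nothing. *)
Definition bigOmega_inv (R : realType) (p : nat -> R) : Prop :=
  exists2 C : R, 0 < C & forall r, (0 < r)%N -> C / r%:R <= p r.

Definition bigO_inv (R : realType) (p : nat -> R) : Prop :=
  exists2 C : R, 0 < C & forall r, (0 < r)%N -> `|p r| <= C / r%:R.

Section Conditional.
Context (d : measure_display) (T : measurableType d) (R : realType).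
Variable P : probability T R.

(* Y is a version of E[X | G], where G is a sigma-algebra on T contained in
   the measurable sets. *)
Definition is_cond_exp (G : set (set T)) (X Y : T -> R) : Prop :=
  [/\ forall C : set R, measurable C -> G (Y @^-1` C),
      P.-integrable setT (EFin \o Y) &
      forall B, G B ->
        (\int[P]_(w in B) (Y w)%:E = \int[P]_(w in B) (X w)%:E)%E].

Definition is_cond_prob (G : set (set T)) (E : set T) (Y : T -> R) : Prop :=
  is_cond_exp G (\1_E) Y.

Definition martingale (F : nat -> set (set T)) (X : nat -> T -> R) : Prop :=
  forall t,
  [/\ forall C : set R, measurable C -> F t (X t @^-1` C),
      P.-integrable setT (EFin \o X t) &
      is_cond_exp (F t) (X t.+1) (X t)].

End Conditional.

Section StickyWalk.
Context (d : measure_display) (T : measurableType d) (R : realType).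
Variables (P : probability T R) (m : nat).
Implicit Type A : nat -> 'I_m -> T -> R.

Definition history A (t : nat) : set (set T) :=
  <<s [set B | exists s i (C : set R),
         [/\ (s <= t)%N, measurable C & B = A s i @^-1` C]] >>.

Definition alive A (t : nat) (w : T) : nat := #|[pred j | A t j w != 0]|.

Definition increases A (t : nat) (i : 'I_m) : set T :=
  [set w | A t i w < A t.+1 i w].

Definition decreases A (t : nat) (i : 'I_m) : set T :=
  [set w | A t.+1 i w < A t i w].

Definition sticky_random_walk (n : R) A : Prop :=
  [/\ 0 < n,
      forall t i w, 0 <= A t i w &
      forall t w, \sum_i A t i w = n] /\
  exists (pm pp : nat -> R) (am ap : R),
    [/\ bigOmega_inv pm, bigO_inv pp, 0 < am & 0 < ap] /\
    forall i : 'I_m,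
    [/\ martingale P (history A) (fun t => A t i),
        forall t, {ae P, forall w, A t i w = 0 -> A t.+1 i w = 0},
        forall t, {ae P, forall w, increases A t i w ->
          forall j, j != i -> 0 < A t j w -> decreases A t j w},
        forall t, exists2 Y : T -> R,
          is_cond_prob P (history A t) (increases A t i) Y &
          {ae P, forall w, (2 <= alive A t w)%N -> 0 < A t i w ->
             pm (alive A t w) <= Y w <= pp (alive A t w)} &
        forall t, {ae P, forall w, decreases A t i w ->
          am <= A t i w - A t.+1 i w <= ap}].

End StickyWalk.

(* The deck is 'I_n, and [None] stands for the empty card. *)
Section War.
Context (m n : nat).

Definition is_deal (h : {ffun 'I_m -> n.-bseq 'I_n}) : bool :=
  perm_eq (flatten [seq (h i : seq 'I_n) | i : 'I_m]) (enum 'I_n).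

Definition state : Type := {h : {ffun 'I_m -> n.-bseq 'I_n} | is_deal h}.

Definition hand (s : state) (i : 'I_m) : seq 'I_n := val s i.

Definition top (s : state) (i : 'I_m) : option 'I_n := ohead (hand s i).

Definition played (s : state) : seq 'I_n := pmap (top s) (enum 'I_m).

Definition absorbing (s : state) : bool := [exists i, size (hand s i) == n].

(* One turn won by player i, leading from s to s'. *)
Definition wins (s : state) (i : 'I_m) (s' : state) : bool :=
  (hand s' i \in [seq behead (hand s i) ++ p | p <- permutations (played s)])
  && [forall j, (j != i) ==> (hand s' j == behead (hand s j))].

(* Cutting the deck shuffled by sg into consecutive hands of sizes sz yields
   s. *)
Definition dealt (sz : 'I_m -> nat) (sg : 'S_n) (s : state) : bool :=
  [forall i : 'I_m,
     hand s i == nth [::] (reshape (codom sz) (codom sg)) i].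

Context (R : realType).
Implicit Type f : option 'I_n -> R.

(* Both are meaningful only for n > 0. *)
Definition card_min f : R :=
  let v := codom (f \o Some) in \big[Num.min/head 0 v]_(y <- v) y.

Definition card_max f : R :=
  let v := codom (f \o Some) in \big[Num.max/head 0 v]_(y <- v) y.

(* The rules fix only the probability that each player wins the turn: the
   distribution of a win over the possible orders of the won cards is free. *)
Definition war_kernel f (Q : state -> state -> R) : Prop :=
  [/\ forall s s', 0 <= Q s s',
      forall s, \sum_s' Q s s' = 1,
      forall s, absorbing s -> Q s s = 1 &
      forall s, ~~ absorbing s -> forall i,
        \sum_(s' | wins s i s') Q s s' = f (top s i) / \sum_j f (top s j)].

(* H is an f-war with initial hand sizes sz. The kernel may depend on the turn,
   so the rule ordering the won cards may change from one turn to the next. *)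
Definition f_war (d : measure_display) (T : measurableType d)
    (P : probability T R) f (sz : 'I_m -> nat) (H : nat -> T -> state) : Prop :=
  [/\ forall t s, measurable [set w | H t w = s],
      forall s, P [set w | H 0%N w = s] =
        (#|[pred sg : 'S_n | dealt sz sg s]|%:R / n`!%:R)%:E &
      exists2 Q : nat -> state -> state -> R,
        forall t, war_kernel f (Q t) &
        forall t (h : nat -> state),
          P [set w | forall u, (u <= t.+1)%N -> H u w = h u] =
          (P [set w | forall u, (u <= t)%N -> H u w = h u] *
            (Q t (h t) (h t.+1))%:E)%E].

End War.

(* Main.v *)
Require Import Defs.
From mathcomp Require Import all_boot all_order all_algebra all_fingroup.
From mathcomp Require Import all_classical all_reals all_analysis.

(** A turn of war is a fair game. Player [i] stakes the top card [a_i], wins the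
    pot (the sum of all the stakes, counted with [f]) with probability
    [f a_i / pot], and otherwise loses the stake, so the expected weight of the
    hand does not change ([mean_weight]); this is where the winning probabilities
    proportional to [f] are used. A hand gains weight exactly when its owner wins
    ([increases_wins]), since two players at least still hold cards before
    absorption and the pot then exceeds every single stake
    ([pot_gt_stake]). Hence the probability of an increase is the ratio
    [f a_i / pot], which is bounded by hypothesis in terms of the number of cards
    played, that is, of players alive ([stake_ratio]). A hand that loses weight
    loses exactly one card, whose weight lies between the minimum [x] of [f] and
    [c * x] ([decrease_card]).

    All this concerns one step of the kernel, conditionally on the full sequence
    of hands, whereas a sticky random walk is conditioned on its own history,
    the coarser sigma-algebra generated by the weights alone. As the hands take
    finitely many values, the events of that history are just the preimages of
    arbitrary sets under the finite-valued map recording the weights so far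
    ([historyP]). They are in particular determined by the past hands, so the
    martingale property comes down to finite sums over the possible pasts
    ([integral_next], [chain_martingale]). For the probability of an increase, the
    conditional expectation is written explicitly as the mean, over the pasts
    with the same recorded weights, of the one-step probability
    ([fiber_mean]). The bounds on the latter depend only on the current weights,
    hence are constant on each such fiber and survive the averaging
    ([chain_cond_prob]). *)

Import Order.TTheory GRing.Theory Num.Theory.

Local Open Scope classical_set_scope.
Local Open Scope ring_scope.

Set Implicit Arguments.
Unset Strict Implicit.

(** * Hands and played cards *)

Section Hands.
Context (m n : nat).
Implicit Type s : state m n.

(** The hands partition the deck. Counting cards and weighing them are both
    instances. *)
Lemma sum_hands (V : nmodType) (F : 'I_n -> V) s :
  \sum_i \sum_(k <- hand s i) F k = \sum_k F k.
Proof.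
rewrite -[RHS]big_enum -(perm_big _ (valP s)) /= big_flatten big_map.
by rewrite -[LHS]big_enum.
Qed.

Lemma sum_size_hands s : (\sum_i size (hand s i) = n)%N.
Proof.
rewrite -[RHS]card_ord -sum1_card; rewrite -[RHS](sum_hands (fun=> 1%N) s).
by apply: eq_bigr => i _; rewrite sum1_size.
Qed.

(** Before absorption no player holds the whole deck. *)
Lemma nonabsorbing_opponent s (i : 'I_m) : ~~ absorbing s ->
  exists2 j, j != i & hand s j != [::].
Proof.
rewrite negb_exists => /forallP /(_ i) hi.
apply/exists2P; apply: contra_notP (negP hi) => /forallNP none.
rewrite -[X in _ == X](sum_size_hands s) (bigD1 i) //= big1 ?addn0 // => j ji.
by apply/eqP; rewrite size_eq0; apply: contra_notT (none j) => hj.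
Qed.

Lemma absorbing_other s (i j : 'I_m) :
  absorbing s -> hand s i != [::] -> hand s j != [::] -> i = j.
Proof.
case/existsP => k /eqP hk.
suff only l : hand s l != [::] -> l = k by move=> /only-> /only->.
apply: contra_neq_eq => lk; apply/eqP; rewrite -size_eq0.
have := sum_size_hands s.
rewrite (bigD1 k) //= hk (bigD1 l) //= => /eqP.
by rewrite -[X in _ == X]addn0 eqn_add2l addn_eq0 => /andP[].
Qed.

(** The played cards form a subsequence of the concatenated hands, which is a
    permutation of the deck. *)
Lemma played_uniq s : uniq (played s).
Proof.
have sub l : subseq (pmap (top s) l) (flatten [seq hand s i | i <- l]).
  elim: l => //= i l IH; rewrite /top /hand.
  case: (val s i : seq _) => [//|a r] /=.
  by rewrite eqxx; apply: subseq_trans IH (suffix_subseq _ _).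
apply: subseq_uniq (sub _) _.
by rewrite (perm_uniq (valP s)) enum_uniq.
Qed.

Lemma size_played s : size (played s) = #|[pred i | hand s i != [::]]|.
Proof.
rewrite size_pmap -size_filter cardE /enum_mem.
rewrite -filter_predI.
congr size; apply: eq_filter => i; rewrite !inE /top.
by case: (hand s i).
Qed.

Lemma mem_played s i a : top s i = Some a -> a \in played s.
Proof.
by move=> si; rewrite mem_pmap -si map_f ?mem_enum.
Qed.

End Hands.

(** * One turn of war *)

Section Turn.
Context (R : realType) (m n : nat) (f : option 'I_n -> R).
Hypothesis f_none : f None = 0.
Hypothesis f_some : forall k : 'I_n, 0 < f (Some k).
Implicit Types (s : state m n) (i j : 'I_m).

Definition weight s i : R := \sum_(k <- hand s i) f (Some k).

Definition pot s : R := \sum_j f (top s j).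

Lemma stake_ge0 s i : 0 <= f (top s i).
Proof. by rewrite /top; case: (hand s i) => [|a l] /=; [rewrite f_none|exact: ltW]. Qed.

Lemma stake_gt0 s i : (0 < f (top s i)) = (hand s i != [::]).
Proof. by rewrite /top; case: (hand s i) => [|a l] /=; rewrite ?f_none ?ltxx ?f_some. Qed.

Lemma weight_behead s i :
  weight s i - f (top s i) = \sum_(k <- behead (hand s i)) f (Some k).
Proof.
rewrite /weight /top; case: (hand s i) => [|a l] /=.
  by rewrite !big_nil f_none subr0.
by rewrite big_cons addrAC subrr add0r.
Qed.

Lemma weight_ge0 s i : 0 <= weight s i.
Proof. by apply: sumr_ge0 => k _; apply: ltW. Qed.

Lemma weight_gt0 s i : (0 < weight s i) = (hand s i != [::]).
Proof.
rewrite /weight; case: (hand s i) => [|a l]; first by rewrite big_nil ltxx.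
rewrite big_cons ltr_wpDr //; first by apply: sumr_ge0 => k _; apply: ltW.
Qed.

Lemma sum_played s : \sum_(k <- played s) f (Some k) = pot s.
Proof.
rewrite /pot /played -[RHS]big_enum /=.
elim: (enum _) => [|i l IH] /=; first by rewrite !big_nil.
rewrite big_cons -IH; case: (top s i) => [a|] /=; first by rewrite big_cons.
by rewrite f_none add0r.
Qed.

Lemma pot_gt_stake s i : ~~ absorbing s -> f (top s i) < pot s.
Proof.
move=> /(@nonabsorbing_opponent _ _ _ i)[j ji hj].
rewrite /pot (bigD1 i) //= (bigD1 j) //= ltrDl ltr_wpDr ?stake_gt0 //.
by apply: sumr_ge0 => k _; apply: stake_ge0.
Qed.

Lemma pot_gt0 s (i : 'I_m) : ~~ absorbing s -> 0 < pot s.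
Proof. by move=> /pot_gt_stake -/(_ i); apply: le_lt_trans; apply: stake_ge0. Qed.

Lemma weight_winner s i s' : wins s i s' ->
  weight s' i = weight s i - f (top s i) + pot s.
Proof.
case/andP => /mapP[p]; rewrite mem_permutations => pP hs' _.
rewrite weight_behead /weight hs' big_cat /=; congr (_ + _).
by rewrite -sum_played; apply: perm_big.
Qed.

Lemma weight_loser s i s' j : wins s i s' -> j != i ->
  weight s' j = weight s j - f (top s j).
Proof.
case/andP => _ /forallP /(_ j) /implyP w ji.
by rewrite weight_behead /weight (eqP (w ji)).
Qed.

(** The weights of player [i] after a win and after a loss differ by the
    positive pot, so the next state reveals who won the turn. *)
Lemma winner_inj s s' i j :
  ~~ absorbing s -> wins s i s' -> wins s j s' -> i = j.
Proof.
move=> na wi wj; apply: contraTeq (pot_gt0 i na) => ij.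
have /eqP := weight_winner wi; rewrite (weight_loser wj ij).
by rewrite -subr_eq0 opprD addNKr oppr_eq0 => /eqP ->; rewrite ltxx.
Qed.

Context (Q : state m n -> state m n -> R) (kQ : war_kernel f Q).

Lemma absorbing_step s s' : absorbing s -> Q s s' != 0 -> s' = s.
Proof.
case: kQ => Q0 Q1 Qa _ /Qa Qss; apply: contraNeq => ss'.
have /eqP := Q1 s; rewrite (bigD1 s) //= Qss -subr_eq0 addrAC subrr add0r.
by rewrite psumr_eq0 // => /allP /(_ s'); rewrite mem_index_enum ss' => /(_ isT).
Qed.

(** Each successor state has at most one winner, and the winning probabilities
    of the players already add up to 1, so states without a winner have
    probability 0. The player [i0] is only there to make the set of players
    nonempty. *)
Lemma nonabsorbing_step s s' (i0 : 'I_m) : ~~ absorbing s -> Q s s' != 0 ->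
  exists2 i, hand s i != [::] & wins s i s'.
Proof.
case: kQ => Q0 Q1 _ Qw na Qss'.
have pot0 : pot s != 0 by rewrite gt_eqF // (pot_gt0 i0).
have tot : \sum_i \sum_(s1 | wins s i s1) Q s s1 = 1.
  under eq_bigr do rewrite Qw //.
  by rewrite -mulr_suml divff.
have [/existsP[i wi]|/existsPn nowin] := boolP [exists i, wins s i s'].
  exists i => //; rewrite -stake_gt0 lt_def stake_ge0 andbT.
  apply: contraNneq Qss' => fi; have /eqP := Qw s na i.
  rewrite fi mul0r psumr_eq0 // => /allP /(_ s').
  by rewrite mem_index_enum wi => /(_ isT).
(* At most one of the summands is nonzero, by uniqueness of the winner. *)
have le_step s1 : \sum_i (if wins s i s1 then Q s s1 else 0) <= Q s s1.
  have [/existsP[i wi]|/existsPn lose] := boolP [exists i, wins s i s1].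
    rewrite (bigD1 i) //= wi big1 ?addr0 // => j ji; case: ifP => // wj.
    by rewrite (winner_inj na wi wj) eqxx in ji.
  by rewrite big1 // => i _; rewrite (negbTE (lose i)).
have : \sum_s1 (Q s s1 - \sum_i (if wins s i s1 then Q s s1 else 0)) == 0.
  rewrite big_split /= sumrN Q1 exchange_big /= -{1}tot subr_eq0; apply/eqP.
  by apply: eq_bigr => i _; rewrite big_mkcond.
rewrite psumr_eq0 => [/allP /(_ s')|s1 _]; last by rewrite subr_ge0.
rewrite mem_index_enum big1 => [/(_ isT)|i _]; last by rewrite (negbTE (nowin i)).
by rewrite subr0 (negbTE Qss').
Qed.

(** On average the winner's pot exactly compensates everybody's stakes: player
    [i] pays [f (top s i)] and receives the pot with probability
    [f (top s i) / pot s]. *)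
Lemma mean_weight s i : \sum_s' Q s s' * weight s' i = weight s i.
Proof.
case: kQ => Q0 Q1 Qa Qw; have [abs|na] := boolP (absorbing s).
  rewrite (bigD1 s) //= Qa // mul1r big1 ?addr0 // => s' ss'.
  by have [->|/(absorbing_step abs)/eqP] := eqVneq (Q s s') 0;
    rewrite ?mul0r // (negbTE ss').
transitivity (\sum_s' (Q s s' * (weight s i - f (top s i)) +
                       (if wins s i s' then Q s s' else 0) * pot s)).
  apply: eq_bigr => s' _; have [->|Qs'] := eqVneq (Q s s') 0.
    by rewrite if_same !mul0r addr0.
  have [k _ wk] := nonabsorbing_step i na Qs'.
  case: ifPn => [wi|nwi]; first by rewrite (weight_winner wi) mulrDr.
  rewrite mul0r addr0 (weight_loser wk) //.
  by apply: contraNneq nwi => ->.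
rewrite big_split /= -!mulr_suml Q1 -big_mkcond /= Qw // mul1r.
by rewrite mulfVK ?subrK // gt_eqF // (pot_gt0 i).
Qed.

(** A win is a strict gain because some opponent has staked a card as well. *)
Lemma increases_wins s s' i : ~~ absorbing s -> Q s s' != 0 ->
  (weight s i < weight s' i) = wins s i s'.
Proof.
move=> na Qs'; have [k hk wk] := nonabsorbing_step i na Qs'.
apply/idP/idP => [|wi].
  apply: contraTT => nwi; rewrite (weight_loser wk).
    by rewrite -leNgt gerBl stake_ge0.
  by apply: contraNneq nwi => ->.
by rewrite (weight_winner wi) -addrA ltrDl addrC subr_gt0 pot_gt_stake.
Qed.

Lemma prob_increase s i : ~~ absorbing s ->
  \sum_s' Q s s' * (weight s i < weight s' i)%R%:R = f (top s i) / pot s.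
Proof.
move=> na; case: kQ => _ _ _ <- //; rewrite [RHS]big_mkcond /=.
apply: eq_bigr => s' _; have [->|Qs'] := eqVneq (Q s s') 0.
  by rewrite mul0r if_same.
by rewrite increases_wins //; case: wins; rewrite ?mulr1 ?mulr0.
Qed.

Lemma dead_step s s' i : Q s s' != 0 -> hand s i = [::] -> hand s' i = [::].
Proof.
move=> Qs' hi; have [abs|na] := boolP (absorbing s).
  by rewrite (absorbing_step abs Qs').
have [k hk /andP[_ /forallP /(_ i) /implyP loser]] := nonabsorbing_step i na Qs'.
rewrite (eqP (loser _)) ?hi //.
by apply: contraNneq hk => <-; rewrite hi.
Qed.

Lemma increase_all_others_decrease s s' i j : Q s s' != 0 ->
  weight s i < weight s' i -> j != i -> hand s j != [::] ->
  weight s' j < weight s j.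
Proof.
move=> Qs' inc ji hj; have [abs|na] := boolP (absorbing s).
  by move: inc; rewrite (absorbing_step abs Qs') ltxx.
move: inc; rewrite increases_wins // => wi.
by rewrite (weight_loser wi ji) gtrBl stake_gt0.
Qed.

(** Only a played card is ever lost. *)
Lemma decrease_card s s' i : Q s s' != 0 -> weight s' i < weight s i ->
  exists k, weight s i - weight s' i = f (Some k).
Proof.
move=> Qs' dec; have [abs|na] := boolP (absorbing s).
  by move: dec; rewrite (absorbing_step abs Qs') ltxx.
have [k hk wk] := nonabsorbing_step i na Qs'.
have [ik|ik] := eqVneq i k.
  have inc := increases_wins k na Qs'; rewrite wk in inc.
  by have := lt_trans dec; rewrite ik => /(_ _ inc); rewrite ltxx.
move: dec; rewrite (weight_loser wk ik) gtrBl opprB addrC subrK /top.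
by case: (hand s i) => [|a l] /=; rewrite ?f_none ?ltxx // => _; exists a.
Qed.

(** The cards played form a set with as many elements as there are nonempty
    hands, to which the assumption on [f] applies. *)
Lemma stake_ratio s i (pm pp : nat -> R) :
  (forall (r : nat) (S : {set 'I_n}), #|S| = r -> forall a, a \in S ->
     pm r <= f (Some a) / (\sum_(k in S) f (Some k)) <= pp r) ->
  hand s i != [::] ->
  pm #|[pred j | hand s j != [::]]| <= f (top s i) / pot s
    <= pp #|[pred j | hand s j != [::]]|.
Proof.
move=> hp hi; case topi: (top s i) => [a|]; last first.
  by move: topi hi; rewrite /top; case: (hand s i).
have cardS : #|[set k in played s]| = #|[pred j | hand s j != [::]]|.
  by rewrite cardsE -size_played; apply/card_uniqP/played_uniq.
have aS : a \in [set k in played s] by rewrite inE (mem_played topi).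
suff -> : pot s = \sum_(k in [set k in played s]) f (Some k).
  exact: hp cardS _ aS.
rewrite -sum_played big_uniq ?played_uniq //.
by apply: eq_bigl => k; rewrite inE.
Qed.

End Turn.

(** * Extreme card values *)

Section Deck.
Context (R : realType) (n : nat) (f : option 'I_n -> R).
Hypotheses (n_gt0 : (0 < n)%N) (f_some : forall k : 'I_n, 0 < f (Some k)).

Lemma card_min_le k : card_min f <= f (Some k).
Proof.
rewrite /card_min codomE big_map big_enum /=.
exact: (bigmin_le _ k (fun k => f (Some k))).
Qed.

Lemma card_max_ge k : f (Some k) <= card_max f.
Proof.
rewrite /card_max codomE big_map big_enum /=.
exact: (le_bigmax _ (fun k => f (Some k)) k).
Qed.

Lemma card_min_gt0 : 0 < card_min f.
Proof.
rewrite /card_min codomE big_map.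
apply: lt_bigmin => [|k _]; last exact: f_some.
have: (0 < size (enum 'I_n))%N by rewrite size_enum_ord.
by case: (enum _) => //= k l _; apply: f_some.
Qed.

End Deck.

(** * Finite-valued random variables *)

Section FiniteValued.
Context (d : measure_display) (T : measurableType d) (R : realType).
Variable P : probability T R.
Context (V : finType) (W : T -> V).
Hypothesis mW : forall v, measurable (W @^-1` [set v]).

Definition law (v : V) : R := fine (P (W @^-1` [set v])).

Lemma law_ge0 v : 0 <= law v.
Proof. exact: fine_ge0. Qed.

Lemma preimageE (D : {pred V}) :
  W @^-1` [set` D] = \big[setU/set0]_(v <- enum D) W @^-1` [set v].
Proof.
rewrite -bigcup_seq; apply/seteqP; split=> [w /= Dw|w [v /=]].
  by exists (W w); rewrite //= mem_enum.
by rewrite mem_enum => Dv ->.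
Qed.

Lemma measurable_fin (D : set V) : measurable (W @^-1` D).
Proof.
rewrite -(set_mem_set D) (preimageE (mem D)).
exact: bigsetU_measurable.
Qed.

Lemma measurable_fun_fin (g : V -> R) : measurable_fun setT (g \o W).
Proof.
by move=> _ C _; rewrite setTI comp_preimage; apply: measurable_fin.
Qed.

Lemma integrable_fin (g : V -> R) : P.-integrable setT (EFin \o (g \o W)).
Proof.
apply: measurable_bounded_integrable => //.
- exact: le_lt_trans (probability_le1 P measurableT) (ltry _).
- exact: measurable_fun_fin.
exists (\sum_v `|g v|); split; first exact: num_real.
move=> M ltM w _; apply: le_trans (ltW ltM).
by rewrite /= (bigD1 (W w)) //= lerDl sumr_ge0.
Qed.

Lemma integral_fin (D : {pred V}) (g : V -> R) :
  (\int[P]_(w in W @^-1` [set` D]) (g (W w))%:E =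
   (\sum_(v in D) law v * g v)%:E)%E.
Proof.
rewrite preimageE integral_bigsetU_EFin ?enum_uniq //; first last.
- apply/measurable_realfun.measurable_EFinP; apply: measurable_funTS; exact: measurable_fun_fin.
- by apply/trivIsetP => v v' _ _ /eqP vv'; apply/seteqP; split=> // w [/= Wv Wv'];
    apply: vv'; rewrite -Wv.
rewrite big_enum /= -sumEFin; apply: eq_bigr => v _.
transitivity (\int[P]_(w in W @^-1` [set v]) cst (g v)%:E w)%E.
  by apply: eq_integral => w /set_mem /= ->.
rewrite integral_cst // EFinM muleC /law fineK //.
exact: fin_num_measure.
Qed.

Lemma prob_fin (D : {pred V}) : P (W @^-1` [set` D]) = (\sum_(v in D) law v)%:E.
Proof.
rewrite -[LHS]mul1e -integral_cst; last exact: measurable_fin.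
rewrite (integral_fin D (fun=> 1)); congr EFin.
by apply: eq_bigr => v _; rewrite mulr1.
Qed.

Lemma ae_law : {ae P, forall w, law (W w) != 0}.
Proof.
exists (W @^-1` [set` [pred v | law v == 0]]); split=> [||w /= /negP].
- exact: measurable_fin.
- rewrite (prob_fin [pred v | law v == 0]) big1 // => v.
  by rewrite inE => /eqP.
by rewrite negbK.
Qed.

End FiniteValued.

(** * Conditional expectation given a finite-valued map *)

Section ConditionalExpectation.
Context (d : measure_display) (T : measurableType d) (R : realType).
Variable P : probability T R.
Context (V : finType) (W : T -> V) (U : eqType) (phi : V -> U).
Hypothesis mW : forall v, measurable (W @^-1` [set v]).

(** Conditional expectation of [x (W w)] given [phi (W w) = u]. On a null fiber the
    quotient is 0 by convention, which is harmless since such fibers carry no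
    mass. *)
Definition fiber_mean (x : V -> R) (u : U) : R :=
  (\sum_(v | phi v == u) law P W v * x v) / \sum_(v | phi v == u) law P W v.

(** The bounds are constant on each fiber of [phi], and a mean of values lying
    between two constants lies between them; [W] almost surely avoids the null
    fibers. *)
Lemma fiber_mean_bounds (x : V -> R) (E : pred U) (lo up : U -> R) :
  (forall v, E (phi v) -> lo (phi v) <= x v <= up (phi v)) ->
  {ae P, forall w, E (phi (W w)) ->
    lo (phi (W w)) <= fiber_mean x (phi (W w)) <= up (phi (W w))}.
Proof.
move=> bounds; apply: filterS (ae_law P mW) => w lawW Ew.
set u := phi (W w) in Ew *.
have tot_gt0 : 0 < \sum_(v | phi v == u) law P W v.
  rewrite (bigD1 (W w)) //= ltr_wpDr ?lt_def ?lawW ?law_ge0 //.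
  by apply: sumr_ge0 => v _; apply: law_ge0.
rewrite /fiber_mean ler_pdivlMr // ler_pdivrMr // !mulr_sumr.
apply/andP; split; apply: ler_sum => v /eqP phiv; rewrite [_ * law _ _ _]mulrC;
  apply: ler_wpM2l; rewrite ?law_ge0 //;
  by have := bounds v; rewrite phiv => /(_ Ew)/andP[].
Qed.

(** Both integrals are sums over the pairs [(v, v')] of points in a common fiber
    inside [D], and exchanging [v] and [v'] turns one into the other. *)
Lemma fiber_mean_integral (x : V -> R) (D : set U) :
  (\int[P]_(w in (phi \o W) @^-1` D) (fiber_mean x (phi (W w)))%:E =
   \int[P]_(w in (phi \o W) @^-1` D) (x (W w))%:E)%E.
Proof.
have -> : (phi \o W) @^-1` D = W @^-1` [set` [pred v | phi v \in D]].
  by apply/seteqP; split=> w /=; rewrite ?inE.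
rewrite (integral_fin P mW _ (fun v => fiber_mean x (phi v))).
rewrite (integral_fin P mW); congr EFin.
pose tot u := \sum_(v | phi v == u) law P W v.
transitivity (\sum_(v | phi v \in D) \sum_(v' | phi v' == phi v)
    law P W v * (law P W v' * x v' / tot (phi v))).
  by apply: eq_bigr => v _; rewrite -mulr_sumr -mulr_suml.
rewrite (exchange_big_dep (fun v => phi v \in D)) /=; last first.
  by move=> v v' Dv /eqP ->.
apply: eq_bigr => v Dv.
transitivity (\sum_(v' | phi v' == phi v) law P W v' * (law P W v * x v / tot (phi v))).
  apply: eq_big => [v'|v' /andP[_ /eqP ->] //]; rewrite eq_sym.
  by case: eqP => [->|]; rewrite ?andbF ?Dv.
rewrite -mulr_suml -/(tot (phi v)) mulrC.
(* In a null fiber both sides vanish, since the summand [law P W v] does. *)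
have [|tot0] := eqVneq (tot (phi v)) 0; last by rewrite mulfVK.
move=> /eqP; rewrite psumr_eq0 => [/allP /(_ v)|v' _]; last exact: law_ge0.
by rewrite mem_index_enum eqxx => /(_ isT)/eqP ->; rewrite !mul0r.
Qed.

End ConditionalExpectation.

(** * Finite Markov chains and their observables *)

Section Chain.
Context (d : measure_display) (T : measurableType d) (R : realType).
Variable P : probability T R.
Context (S : finType) (H : nat -> T -> S) (Q : nat -> S -> S -> R).
Hypothesis mH : forall t s, measurable [set w | H t w = s].
Hypothesis step : forall t (h : nat -> S),
  P [set w | forall u, (u <= t.+1)%N -> H u w = h u] =
  (P [set w | forall u, (u <= t)%N -> H u w = h u] *
    (Q t (h t) (h t.+1))%:E)%E.

Definition past t (w : T) : {ffun 'I_t.+1 -> S} := [ffun u : 'I_t.+1 => H u w].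

Lemma past_last t w : past t w ord_max = H t w.
Proof. by rewrite ffunE. Qed.

Definition past_next t (w : T) := (past t w, H t.+1 w).

Lemma past_fiber t p :
  past t @^-1` [set p] = [set w | forall u, (u <= t)%N -> H u w = p (inord u)].
Proof.
apply/seteqP; split=> w /=.
  by move=> <- u ut; rewrite ffunE inordK.
by move=> Hp; apply/ffunP => u; rewrite ffunE Hp ?inord_val // -ltnS.
Qed.

Lemma measurable_past t p : measurable (past t @^-1` [set p]).
Proof.
rewrite [X in measurable X](_ : _ =
    \bigcap_(u in [set: 'I_t.+1]) [set w | H u w = p u]).
  by apply: fin_bigcap_measurable => // u _; apply: mH.
apply/seteqP; split=> w /=; first by move=> <- u _; rewrite /= ffunE.
by move=> Hp; apply/ffunP => u; rewrite ffunE; apply: Hp.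
Qed.

Lemma past_next_fiber t p s :
  past_next t @^-1` [set (p, s)] =
  past t @^-1` [set p] `&` [set w | H t.+1 w = s].
Proof. by apply/seteqP; rewrite /past_next; split=> w /= [<- <-]. Qed.

Lemma measurable_past_next t ps : measurable (past_next t @^-1` [set ps]).
Proof.
case: ps => p s; rewrite past_next_fiber.
exact: measurableI (measurable_past p) (mH t.+1 s).
Qed.

(** The transition rule, restated for the joint law of the past and the next
    state. *)
Lemma law_past_next t p s :
  law P (past_next t) (p, s) = law P (past t) p * Q t (p ord_max) s.
Proof.
(* The transition rule speaks of infinite sequences of states: extend [p] by
   the constant [s]. *)
pose h u := if (u <= t)%N then p (inord u) else s.
have ht : h t = p ord_max.
  by rewrite /h leqnn; congr (p _); apply: val_inj; rewrite /= inordK.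
have ht1 : h t.+1 = s by rewrite /h ltnn.
rewrite /law past_next_fiber past_fiber.
have -> : [set w | forall u, (u <= t)%N -> H u w = p (inord u)] =
          [set w | forall u, (u <= t)%N -> H u w = h u].
  by apply/seteqP; split=> w /= Hp u ut; rewrite Hp // /h ut.
rewrite -{1}ht1 -[X in P (X `&` _)]setTI.
have -> : [set: T] `&` [set w | forall u, (u <= t)%N -> H u w = h u] `&`
            [set w | H t.+1 w = h t.+1] =
          [set w | forall u, (u <= t.+1)%N -> H u w = h u].
  apply/seteqP; split=> w /= => [[[_ Hh] Ht1] u|Hh].
    by rewrite leq_eqVlt ltnS => /predU1P[->|/Hh].
  by split; [split=> // u ut; apply: Hh; apply: leqW|apply: Hh].
rewrite step ht ht1 fineM // ?fin_num_measure //.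
rewrite [X in measurable X](_ : _ = past t @^-1` [set p]).
  exact: measurable_past.
rewrite past_fiber; apply/seteqP; split=> w /= Hp u ut;
  by rewrite Hp // /h ut.
Qed.

Lemma integral_next t (D : {pred {ffun 'I_t.+1 -> S}})
    (g : {ffun 'I_t.+1 -> S} -> S -> R) :
  (\int[P]_(w in past t @^-1` [set` D]) (g (past t w) (H t.+1 w))%:E =
   (\sum_(p in D) law P (past t) p *
      \sum_s Q t (p ord_max) s * g p s)%:E)%E.
Proof.
have := integral_fin P (@measurable_past_next t) [pred ps | ps.1 \in D]
  (fun ps => g ps.1 ps.2).
rewrite [X in (\int[P]_(w in X) _)%E](_ : _ = past t @^-1` [set` D]) //.
move=> ->; congr EFin.
transitivity (\sum_(p in D) \sum_s law P (past_next t) (p, s) * g p s).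
  rewrite pair_big /=.
  by apply: eq_big => [[p s]|[p s] _] //=; rewrite !inE andbT.
apply: eq_bigr => p _; rewrite mulr_sumr; apply: eq_bigr => s _.
by rewrite law_past_next mulrA.
Qed.

Lemma ae_step t : {ae P, forall w, Q t (H t w) (H t.+1 w) != 0}.
Proof.
apply: filterS (ae_law P (@measurable_past_next t)) => w.
by rewrite law_past_next past_last mulf_eq0 => /norP[].
Qed.

Section Observable.
Context (m : nat) (g : S -> 'I_m -> R).

Let A t i w := g (H t w) i.

Definition trace t (p : {ffun 'I_t.+1 -> S}) : {ffun 'I_t.+1 * 'I_m -> R} :=
  [ffun ui => g (p ui.1) ui.2].

(** The trace takes finitely many values on the pasts, so its level sets, which are
    finite intersections of generators, generate everything by finite unions. *)
Lemma historyP t (B : set T) :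
  history A t B <-> exists D, B = (@trace t \o past t) @^-1` D.
Proof.
split=> [|[D ->]].
  move: B; apply: smallest_sub => [|B [s [i [C [st _ ->]]]]].
    split=> [|_ [D ->]|F].
    - by exists set0.
    - by exists (~` D); rewrite setTD.
    move=> /choice[D FD]; exists (\bigcup_k D k).
    by rewrite preimage_bigcup; apply: eq_bigcupr => k _.
  exists [set y | C (y (inord s, i))].
  by apply/seteqP; split=> w /=; rewrite !ffunE /= inordK.
set G := [set B | exists s i (C : set R),
         [/\ (s <= t)%N, measurable C & B = A s i @^-1` C]].
rewrite (_ : _ @^-1` D = \bigcup_(p in [set p | D (@trace t p)])
    \bigcap_(ui in [set: 'I_t.+1 * 'I_m]) A ui.1 ui.2 @^-1` [set g (p ui.1) ui.2]).
  apply: (@fin_bigcup_measurable _ (g_sigma_algebraType G)) => // p _.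
  apply: (@fin_bigcap_measurable _ (g_sigma_algebraType G)) => // ui _.
  apply: sub_sigma_algebra; exists ui.1, ui.2, [set g (p ui.1) ui.2]; split=> //.
  by rewrite -ltnS.
apply/seteqP; split=> w /= => [Dw|[p Dp Hp]].
  by exists (past t w) => // ui _; rewrite /= ffunE.
suff -> : trace (past t w) = trace p by [].
by apply/ffunP => ui; rewrite !ffunE -(Hp ui).
Qed.

Lemma history_past t B : history A t B -> exists D : {pred {ffun 'I_t.+1 -> S}},
  B = past t @^-1` [set` D].
Proof.
case/historyP => D ->; exists (fun p => @trace t p \in D).
by apply/seteqP; split=> w /=; rewrite ?inE.
Qed.

Lemma measurable_at t s : measurable (H t @^-1` [set s]).
Proof. exact: mH. Qed.

(** Harmonicity of each observable gives the martingale property over the whole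
    past; since the observable is adapted to its own history, the property
    holds over that coarser history as well. *)
Lemma chain_martingale (i : 'I_m) :
  (forall t s, \sum_s' Q t s s' * g s' i = g s i) ->
  martingale P (history A) (fun t => A t i).
Proof.
move=> mean t.
have adapted C : measurable C -> history A t (A t i @^-1` C).
  by move=> mC; apply: sub_sigma_algebra; exists t, i, C.
have int : P.-integrable setT (EFin \o A t i).
  exact: (integrable_fin P (@measurable_at t) (g^~ i)).
split=> //; split=> // B /history_past[D ->].
rewrite (integral_next D (fun _ s => g s i)).
transitivity (\int[P]_(w in past t @^-1` [set` D]) (g (past t w ord_max) i)%:E)%E.
  by apply: eq_integral => w _; rewrite past_last.
rewrite (integral_fin P (@measurable_past t) D (fun p => g (p ord_max) i)).
by congr EFin; apply: eq_bigr => p _; rewrite mean.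
Qed.

(** The one-step probability of [e] is the conditional probability given the whole
    past. Averaging it over the pasts with the same trace gives the conditional
    probability given the history of the observables, and the bounds survive
    as they are functions of the current observables. *)
Lemma chain_cond_prob t (e : rel S) (E : ('I_m -> R) -> bool)
    (lo up : ('I_m -> R) -> R) :
  (forall s, E (g s) ->
     lo (g s) <= \sum_s' Q t s s' * (e s s')%:R <= up (g s)) ->
  exists2 Y, is_cond_prob P (history A t) [set w | e (H t w) (H t.+1 w)] Y &
    {ae P, forall w, E (g (H t w)) ->
       lo (g (H t w)) <= Y w <= up (g (H t w))}.
Proof.
move=> bounds.
pose q (p : {ffun 'I_t.+1 -> S}) :=
  \sum_s' Q t (p ord_max) s' * (e (p ord_max) s')%:R.
pose now (y : {ffun 'I_t.+1 * 'I_m -> R}) i := y (ord_max, i).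
have nowE p : now (@trace t p) = g (p ord_max).
  by apply/funext => i; rewrite /now ffunE.
exists (fiber_mean P (past t) (@trace t) q \o @trace t \o past t); last first.
  have := @fiber_mean_bounds _ _ _ P _ _ _ (@trace t) (@measurable_past t) q
    (E \o now) (lo \o now) (up \o now).
  move=> /(_ _)/filterS; apply=> [w /=|p /=]; first by rewrite nowE past_last.
  by rewrite nowE; apply: bounds.
split.
- by move=> C _; apply/historyP; exists (fiber_mean P (past t) (@trace t) q @^-1` C).
- exact: (integrable_fin P (@measurable_past t)
            (fiber_mean P (past t) (@trace t) q \o @trace t)).
move=> B /[dup] /historyP[D ->] /history_past[D' BD'].
rewrite (fiber_mean_integral P _ (@measurable_past t)) BD'.
rewrite (integral_fin P (@measurable_past t) D' q).
transitivity (\int[P]_(w in past t @^-1` [set` D'])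
   (e (past t w ord_max) (H t.+1 w))%:R%:E)%E.
  by rewrite (integral_next D' (fun p s => (e (p ord_max) s)%:R)).
apply: eq_integral => w _; rewrite past_last indicE.
by congr (_%:R%:E); congr nat_of_bool; apply/idP/idP; rewrite inE.
Qed.

End Observable.

End Chain.

Theorem proposition2p8 (R : realType) (m n' : nat) (hm : (2 <= m)%N)
    (hn' : (0 < n')%N)
    (f : option 'I_n' -> R)
    (f_none : f None = 0) (f_some : forall k : 'I_n', 0 < f (Some k))
    (hp : exists pm pp : nat -> R,
        [/\ bigOmega_inv pm, bigO_inv pp &
            forall (r : nat) (S : {set 'I_n'}), #|S| = r ->
              forall a : 'I_n', a \in S ->
              pm r <= f (Some a) / (\sum_(k in S) f (Some k)) <= pp r])
    (c : R) (hc : card_max f <= c * card_min f)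
    (d : measure_display) (T : measurableType d) (P : probability T R)
    (sz : 'I_m -> nat) (hsz : (\sum_i sz i)%N = n')
    (H : nat -> T -> state m n') (hH : f_war P f sz H) :
  exists n : R,
    sticky_random_walk P n
      (fun t i w => (card_min f)^-1 * \sum_(k <- hand (H t w) i) f (Some k)).
Proof.
case: hH => mH _ [Q kQ step]; case: hp => pm [pp [pmO ppO hp]].
set x := card_min f in hc *.
have x_gt0 : 0 < x := card_min_gt0 hn' f_some.
have xV_gt0 : 0 < x^-1 by rewrite invr_gt0.
pose g (s : state m n') i : R := x^-1 * weight f s i.
have g_lt s s' i : (g s i < g s' i) = (weight f s i < weight f s' i).
  by rewrite /g ltr_pM2l.
have g_gt0 s i : (0 < g s i) = (hand s i != [::]).
  by rewrite /g pmulr_rgt0 // weight_gt0.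
have g_ge0 s i : 0 <= g s i by rewrite /g mulr_ge0 ?weight_ge0 // ltW.
have g_neq0 s i : (g s i != 0) = (hand s i != [::]).
  by rewrite -g_gt0 lt_def g_ge0 andbT.
have k0 : 'I_n' := Ordinal hn'.
have c_gt0 : 0 < c.
  rewrite -(pmulr_lgt0 c x_gt0); apply: lt_le_trans hc.
  exact: lt_le_trans (f_some k0) (card_max_ge f k0).
exists (x^-1 * \sum_k f (Some k)); split.
  split.
  - rewrite mulr_gt0 // (bigD1 k0) //= ltr_wpDr ?f_some //.
    by apply: sumr_ge0 => k _; apply: ltW.
  - by move=> t i w; apply: g_ge0.
  - by move=> t w; rewrite -mulr_sumr; congr (_ * _); apply: sum_hands.
exists pm, pp, 1, c; split=> // i.
have aeQ t := ae_step mH step t.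
split=> [|t|t|t|t].
- apply: (chain_martingale mH step (g := g)) => t s.
  rewrite /g; under eq_bigr do rewrite mulrCA.
  by rewrite -mulr_sumr (mean_weight f_none f_some (kQ t)).
- apply: filterS (aeQ t) => w Qw /eqP hi; apply/eqP; move: hi.
  apply: contraLR; rewrite !g_neq0; apply: contra => /eqP hi.
  by rewrite (dead_step f_none f_some (kQ t) Qw hi).
- apply: filterS (aeQ t) => w Qw; rewrite /increases /decreases /=.
  rewrite g_lt => inc j ji; rewrite g_gt0 g_lt => hj.
  exact: (increase_all_others_decrease f_none f_some (kQ t) Qw inc ji hj).
- pose r (y : 'I_m -> R) := #|[pred j | y j != 0]|.
  have rE s : r (g s) = #|[pred j | hand s j != [::]]|.
    by apply: eq_card => j; rewrite !inE g_neq0.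
  have [|Y YP Yb] := @chain_cond_prob _ _ _ P _ _ _ mH step _ g t
    (fun s s' => weight f s i < weight f s' i)
    (fun y => (2 <= r y)%N && (0 < y i)) (pm \o r) (pp \o r).
    move=> s /andP[r2]; rewrite g_gt0 /= => hi.
    have na : ~~ absorbing s.
      apply: contraL r2 => abs; rewrite -ltnNge ltnS rE.
      apply/card_le1_eqP => j k; rewrite !inE.
      by move=> hj hk; apply: absorbing_other hk hj.
    rewrite (prob_increase f_none f_some (kQ t)) // rE.
    by have := stake_ratio f_none hp hi.
  exists Y; last by apply: filterS Yb => w + r2 yi; apply; apply/andP.
  (* Rescaling by [1 / x] does not affect comparisons of weights. *)
  rewrite [increases _ _ _](_ : _ =
    [set w | weight f (H t w) i < weight f (H t.+1 w) i]) //.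
  by apply/seteqP; split=> w; rewrite /increases /= g_lt.
- apply: filterS (aeQ t) => w Qw; rewrite /decreases /= g_lt => dec.
  have [k wk] := decrease_card f_none f_some (kQ t) Qw dec.
  rewrite -mulrBr -/(weight f (H t w) i) -/(weight f (H t.+1 w) i) wk.
  rewrite mulrC ler_pdivlMr // ler_pdivrMr // mul1r card_min_le /=.
  exact: le_trans (card_max_ge f k) hc.
Qed.
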